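(* Let $M$ be a differentiable manifold, $D$ an $S$-derivation, $x_0\in M$, and $X$ a fixed $C^1$ vector field. If $X|_{x_0}\neq 0$, then there exists a local basis $\{E_{i'}\}$ of vector fields, defined in a neighborhood of $x_0$, in which the components of $D_X$ along $X$ vanish at $x_0$, i.e. $W'_X(x_0)=0$, where $W'_X$ is the matrix of the components of $D_X$ in $\{E_{i'}\}$. If $X|_{x_0}=0$, then such a basis exists if in some basis $\{E_i\}$ one has $W_X(x_0)=0$.
   Context: $n=\dim M$; latin indices run from $1$ to $n$ and repeated indices on different levels are summed. $S$-derivation: let $S:X\mapsto S_X$ be a map (no linearity is assumed) from $C^1$ vector fields to tensor fields of type $(1,1)$. For each $X$ the formula $D_X=L_X+S_X$ defines a derivation of the tensor algebra over $M$, where $L_X$ is the Lie derivative along $X$ and $S_X$ acts as the algebraic derivation induced by the endomorphism field $S_X$ (so $S_X f=0$ on functions and $S_X Y=S_X(Y)$ on vector fields). The map $D:X\mapsto D_X$ is called an $S$-derivation, and $D_X$ the $S$-derivation along $X$. Components: in a local basis (frame) $\{E_i\}$ of $C^1$ vector fields (not necessarily a coordinate one), the components of $D_X$ are the functions $(W_X)^i_{.j}$ defined by $D_X(E_j)=(W_X)^i_{.j}E_i$; $W_X=[(W_X)^i_{.j}]$ is their matrix. *)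

(* Defs.v *)
From HB Require Import structures.
From mathcomp Require Import all_boot all_order all_algebra.
From mathcomp Require Import all_classical all_reals all_analysis.
From mathcomp Require Import lra.
Set Implicit Arguments.
Unset Strict Implicit.
Unset Printing Implicit Defensive.
Import Order.TTheory GRing.Theory Num.Theory.
Import numFieldNormedType.Exports.
Local Open Scope classical_set_scope.
Local Open Scope ring_scope.

(* Meant for an open set O in a finite-dimensional space: all iterated
   directional derivatives of f up to order k exist and are continuous on O. *)
Fixpoint Ck (R : realType) (V W : normedModType R) (k : nat)
    (O : set V) (f : V -> W) : Prop :=
  match k with
  | 0 => forall u, O u -> {for u, continuous f}
  | k'.+1 => (forall u, O u -> differentiable f u) /\
             (forall v, Ck k' O ('D_v f))
  end.

(* A homeomorphism of the open set cdom onto the open set cmap @` cdom, with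
   inverse cinv; the values of cmap and cinv elsewhere are irrelevant. *)
Record chart (R : realType) (n : nat) (T : topologicalType) := Chart {
  cdom : set T;
  cmap : T -> 'rV[R]_n;
  cinv : 'rV[R]_n -> T;
  open_cdom : open cdom;
  open_crange : open (cmap @` cdom);
  cmapK : forall x, cdom x -> cinv (cmap x) = x;
  cmap_continuous : forall x, cdom x -> {for x, continuous cmap};
  cinv_continuous : forall u, (cmap @` cdom) u -> {for u, continuous cinv} }.

Definition transition (R : realType) (n : nat) (T : topologicalType)
  (c d : chart R n T) : 'rV[R]_n -> 'rV[R]_n := cmap d \o cinv c.

(* The atlas is only asked to be of class C^2, the least regularity for which C^1
   vector fields and their Lie brackets make sense; every manifold of class C^r
   with 2 <= r <= oo is an instance. No countability is required. *)
Record manifold (R : realType) (n : nat) := Manifold {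
  carrier :> topologicalType;
  chart_index : Type;
  atlas : chart_index -> chart R n carrier;
  manifold_hausdorff : hausdorff_space carrier;
  atlas_cover : forall x : carrier, exists c, cdom (atlas c) x;
  atlas_compat : forall c d,
    Ck 2 (cmap (atlas c) @` (cdom (atlas c) `&` cdom (atlas d)))
         (transition (atlas c) (atlas d)) }.

Section Charts.
Context {R : realType} {n : nat} {T : topologicalType}.
Implicit Types (c d e : chart R n T) (x : T) (O : set T).

Lemma open_chart_image c O : open O -> open (cmap c @` (O `&` cdom c)).
Proof.
move=> oO; rewrite openE => _ [x [Ox cx] <-]; rewrite /interior.
have cr : (cmap c @` cdom c) (cmap c x) by exists x.
have ci : cinv c u @[u --> cmap c x] --> x.
  by have := cinv_continuous cr; rewrite -[X in _ --> X](cmapK cx).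
have /ci : nbhs x O by exact: open_nbhs_nbhs.
have : nbhs (cmap c x) (cmap c @` cdom c).
  by apply: open_nbhs_nbhs; split=> //; exact: open_crange.
apply: filterS2 => u [y cy <-] /=; rewrite cmapK// => Oy.
by exists y.
Qed.

Lemma nbhs_chart_image c O x : open O -> O x -> cdom c x ->
  nbhs (cmap c x) (cmap c @` (O `&` cdom c)).
Proof.
move=> oO Ox cx; apply: open_nbhs_nbhs.
by split; [exact: open_chart_image | exists x].
Qed.

Lemma transitionE c d x : cdom c x -> transition c d (cmap c x) = cmap d x.
Proof. by move=> cx; rewrite /transition /= cmapK. Qed.

End Charts.

Lemma near_eq_diff (R : realType) (V W : normedModType R) (f g : V -> W) (u v : V) :
  differentiable f u -> differentiable g u -> {near u, f =1 g} ->
  'd f u v = 'd g u v.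
Proof. by move=> fu gu fg; rewrite -!deriveE//; exact: near_eq_derive. Qed.

Lemma diff_chain (R : realType) (U V W : normedModType R)
    (f : U -> V) (g : V -> W) (h : U -> W) (u v : U) (w : V) :
  differentiable f u -> f u = w -> differentiable g w -> differentiable h u ->
  {near u, g \o f =1 h} -> 'd g w ('d f u v) = 'd h u v.
Proof.
move=> df <- dg dh gfh.
have dgf : differentiable (g \o f) u by exact: differentiable_comp.
by rewrite -(near_eq_diff v dgf dh gfh) (diff_comp df dg).
Qed.

Section Transition.
Context {R : realType} {n : nat} {M : manifold R n}.
Implicit Types (c d e : chart_index M) (x : M).
Local Notation tr c d := (transition (atlas c) (atlas d)).

Lemma differentiable_transition c d x : cdom (atlas c) x -> cdom (atlas d) x ->
  differentiable (tr c d) (cmap (atlas c) x).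
Proof. by move=> cx dx; apply: (atlas_compat c d).1; exists x. Qed.

Lemma diff_transition_id c x v : cdom (atlas c) x ->
  'd (tr c c) (cmap (atlas c) x) v = v.
Proof.
move=> cx; have did : 'd id (cmap (atlas c) x) = id :> ('rV[R]_n -> 'rV[R]_n).
  exact: diff_val.
rewrite -[RHS](congr1 (@^~ v) did); apply: near_eq_diff.
- exact: differentiable_transition.
- exact: ex_diff.
- have : nbhs (cmap (atlas c) x) (cmap (atlas c) @` (setT `&` cdom (atlas c))).
    exact: nbhs_chart_image (@openT _) _ _.
  by apply: filterS => _ [y [_ cy] <-]; rewrite transitionE.
Qed.

Lemma diff_transition_comp c d e x v :
  cdom (atlas c) x -> cdom (atlas d) x -> cdom (atlas e) x ->
  'd (tr d e) (cmap (atlas d) x) ('d (tr c d) (cmap (atlas c) x) v) =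
  'd (tr c e) (cmap (atlas c) x) v.
Proof.
move=> cx dx ex.
apply: (@diff_chain _ _ _ _ (tr c d) (tr d e) (tr c e)).
- exact: differentiable_transition.
- exact: transitionE.
- exact: differentiable_transition.
- exact: differentiable_transition.
- have := nbhs_chart_image (open_cdom (atlas d)) dx cx.
  by apply: filterS => _ [y [dy cy] <-]; rewrite /= !transitionE.
Qed.

End Transition.

Section Tangent.
Context {R : realType} {n : nat} {M : manifold R n}.
Implicit Types (c d : chart_index M) (x : M).

(* A tangent vector at x is the family of its components in all the charts at x,
   subject to the transformation law of contravariant vectors. Components in
   charts not containing x are set to 0, so that equality is Leibniz equality. *)
Definition tangent_pred x : {pred (chart_index M -> 'rV[R]_n)} :=
  fun v => `[< (forall c, ~ cdom (atlas c) x -> v c = 0) /\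
     (forall c d, cdom (atlas c) x -> cdom (atlas d) x ->
        v d = 'd (transition (atlas c) (atlas d)) (cmap (atlas c) x) (v c)) >].

Fact tangent_pred_submod x : submod_closed (tangent_pred x).
Proof.
split; first by apply/asboolP; split=> // c d _ _; rewrite [RHS]linear0.
move=> a u v /asboolP[u0 uE] /asboolP[v0 vE]; apply/asboolP; split=> [c xc|c d xc xd].
  by rewrite -[LHS]/(a *: u c + v c) u0// v0// scaler0 addr0.
by rewrite !fctE (uE c d)// (vE c d)// linearP.
Qed.
HB.instance Definition _ x :=
  GRing.isSubmodClosed.Build R _ (tangent_pred x) (tangent_pred_submod x).

Record tangent x := Tangent {
  tcomp :> chart_index M -> 'rV[R]_n;
  _ : tcomp \in tangent_pred x }.
HB.instance Definition _ x := [isSub for @tcomp x].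
HB.instance Definition _ x := [Choice of tangent x by <:].
HB.instance Definition _ x := [SubChoice_isSubLmodule of tangent x by <:].

Lemma tangent_eq x (v w : tangent x) c : cdom (atlas c) x -> v c = w c -> v = w.
Proof.
case: v w => [v vx] [w wx] /= cx vw; apply: val_inj => /=.
move: vx wx => /asboolP[v0 vE] /asboolP[w0 wE]; apply/funext => d.
by have [dx|ndx] := pselect (cdom (atlas d) x);
  [rewrite (vE c d)// (wE c d)// vw | rewrite v0// w0].
Qed.

Fact tangent_of_subproof c x (xc : cdom (atlas c) x) (v : 'rV[R]_n) :
  (fun d => if `[< cdom (atlas d) x >] then
     'd (transition (atlas c) (atlas d)) (cmap (atlas c) x) v else 0)
  \in tangent_pred x.
Proof.
apply/asboolP; split=> [d ndx|d e dx ex].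
  by rewrite asboolF.
rewrite (asboolT dx) (asboolT ex).
exact: esym (diff_transition_comp v xc dx ex).
Qed.

(* The tangent vector at x with components v in the chart c. *)
Definition tangent_of c x (xc : cdom (atlas c) x) (v : 'rV[R]_n) : tangent x :=
  Tangent (tangent_of_subproof xc v).

Lemma tangent_ofK c x (xc : cdom (atlas c) x) v : tangent_of xc v c = v.
Proof. rewrite /= (asboolT xc); exact: diff_transition_id. Qed.

Definition chart_at x : {c | cdom (atlas c) x} := cid (atlas_cover x).

Fact tangent_vect_iso x : Vector.axiom n (tangent x).
Proof.
exists (fun v : tangent x => v (sval (chart_at x))) => //.
exists (tangent_of (svalP (chart_at x))) => v; last exact: tangent_ofK.
apply: (tangent_eq (svalP (chart_at x))); exact: tangent_ofK.
Qed.
HB.instance Definition _ x := Lmodule_hasFinDim.Build R (tangent x) (tangent_vect_iso x).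

End Tangent.

Section Fields.
Context {R : realType} {n : nat} {M : manifold R n}.

(* Local vector fields are also total functions: regularity is imposed on an open
   set by C1_on, and the values outside that set are irrelevant. *)
Definition vfield := forall x : M, tangent x.

Definition chart_rep (c : chart_index M) (Y : vfield) (u : 'rV[R]_n) : 'rV[R]_n :=
  Y (cinv (atlas c) u) c.

Definition C1_on (U : set M) (Y : vfield) : Prop :=
  forall c, Ck 1 (cmap (atlas c) @` (U `&` cdom (atlas c))) (chart_rep c Y).

Record C1_vfield := C1VField {
  vfield_of :> forall x : M, tangent x;
  _ : C1_on setT vfield_of }.

(* Fields of endomorphisms, with no regularity assumption. *)
Definition tensor11 := forall x : M, {linear tangent x -> tangent x}.

(* [X, Y]^i = X^j d_j Y^i - Y^j d_j X^i in the chart c *)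
Definition bracket_rep (c : chart_index M) (X Y : vfield) (u : 'rV[R]_n) : 'rV[R]_n :=
  'd (chart_rep c Y) u (chart_rep c X u) - 'd (chart_rep c X) u (chart_rep c Y u).

(* L_X Y = [X, Y]. The components are prescribed in one chart at x; LieE below
   shows that, for C^1 fields, the same formula holds in every chart at x. *)
Definition Lie (X Y : vfield) : vfield := fun x =>
  let: exist c xc := chart_at x in
  tangent_of xc (bracket_rep c X Y (cmap (atlas c) x)).

(* The action of D_X = L_X + S_X on vector fields, which is what its components in
   a frame involve; together with D_X f = X f on functions it determines the
   derivation on all tensor fields. S is an arbitrary map. *)
Definition S_derivation (S : C1_vfield -> tensor11) (X : C1_vfield) (Y : vfield) :
    vfield := fun x => Lie X Y x + S X x (Y x).

Definition frame_at (E : 'I_n -> vfield) (x : M) : n.-tuple (tangent x) :=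
  [tuple E i x | i < n].

Definition local_frame (U : set M) (E : 'I_n -> vfield) : Prop :=
  [/\ open U, forall i, C1_on U (E i)
    & forall x, U x -> basis_of fullv (frame_at E x)].

(* W i j is the coefficient of E_i in D (E_j), see componentsE. *)
Definition components (D : vfield -> vfield) (E : 'I_n -> vfield) (x : M) : 'M[R]_n :=
  \matrix_(i, j) coord (frame_at E x) i (D (E j) x).

Lemma componentsE D U E : local_frame U E -> forall x, U x -> forall j,
  D (E j) x = \sum_i components D E x i j *: E i x.
Proof.
move=> [_ _ bE] x Ux j; rewrite [LHS](coord_basis (bE x Ux) (memvf _)).
by apply: eq_bigr => i _; rewrite mxE (nth_map i) ?size_enum_ord// nth_ord_enum.
Qed.

End Fields.
Arguments vfield {R n} M.
Arguments C1_vfield {R n} M.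
Arguments tensor11 {R n} M.

Lemma is_diffW (R : realType) (V W : normedModType R) (x : V) (f df : V -> W) :
  is_diff x f df -> differentiable f x.
Proof. by case. Qed.

Lemma is_diffE (R : realType) (V W : normedModType R) (x : V) (f df : V -> W) :
  is_diff x f df -> 'd f x = df :> (V -> W).
Proof. by case. Qed.

Section Schwarz.
Context {R : realType} {V : normedModType R}.

Lemma is_derive_line (g : V -> R) (a v : V) (s : R) :
  differentiable g (a + s *: v) ->
  is_derive s 1 (fun s => g (a + s *: v)) ('D_v g (a + s *: v)).
Proof.
move=> dg.
have dl : is_diff s (fun s : R => a + s *: v) (fun s => s *: v).
  by apply: is_diff_eq; rewrite add0r.
have dc : differentiable (g \o (fun s : R => a + s *: v)) s.
  by apply: differentiable_comp => //; exact: ex_diff.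
split; first exact: diff_derivable.
rewrite (deriveE _ dc) (diff_comp (is_diffW dl) dg)/= (deriveE _ dg).
by rewrite (is_diffE dl) scale1r.
Qed.

Lemma MVT_line (g : V -> R) (a v : V) (h : R) : 0 < h ->
  (forall s, 0 <= s <= h -> differentiable g (a + s *: v)) ->
  exists2 s, 0 <= s <= h & g (a + h *: v) - g a = h * 'D_v g (a + s *: v).
Proof.
move=> h0 dg.
have [||s sh] := @MVT R (fun s => g (a + s *: v)) (fun s => 'D_v g (a + s *: v)) _ _ h0.
- move=> s; rewrite in_itv/= => /andP[s0 sh].
  by apply/is_derive_line/dg; rewrite !ltW.
- apply: continuous_in_subspaceT => s; rewrite inE/= in_itv/= => sh.
  apply: differentiable_continuous; apply/derivable1_diffP.
  by have [] := is_derive_line (dg _ sh).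
rewrite scale0r addr0 subr0 mulrC => ->; exists s => //.
by move: sh; rewrite in_itv/= => /andP[s0 sh]; rewrite !ltW.
Qed.


End Schwarz.

Lemma second_difference {R : realType} {V : normedModType R} (O : set V) (u v w : V) (g gv : V -> R) (h : R) :
  0 < h -> (forall s t : R, 0 <= s <= h -> 0 <= t <= h -> O (u + s *: v + t *: w)) ->
  (forall y, O y -> differentiable g y) -> (forall y, O y -> differentiable gv y) ->
  (forall y, O y -> 'D_v g y = gv y) ->
  exists s t : R, [/\ 0 <= s <= h, 0 <= t <= h &
    g (u + h *: v + h *: w) - g (u + h *: v) - (g (u + h *: w) - g u) =
    h * (h * 'D_w gv (u + s *: v + t *: w))].
Proof.
move=> h0 Ost dg dgv gvE.
have h00 : (0 : R) <= 0 <= h by rewrite lexx ltW.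
have hh : (0 : R) <= h <= h by rewrite lexx ltW.
have Os s : 0 <= s <= h -> O (u + s *: v).
  by move=> sh; have := Ost s 0 sh h00; rewrite scale0r addr0.
have dsh y : O (y + h *: w) -> is_diff y (fun y => g (y + h *: w)) ('d g (y + h *: w)).
  move=> Oy.
  have dl : is_diff y (fun y : V => y + h *: w) id.
    by apply: is_diff_eq; rewrite addr0.
  have dg' := dg _ Oy.
  have dgi : is_diff (y + h *: w) g ('d g (y + h *: w)) by exact: DiffDef.
  apply: DiffDef.
    exact: (differentiable_comp (f := fun y : V => y + h *: w) (is_diffW dl) dg').
  have -> : (fun y => g (y + h *: w)) = g \o (fun y => y + h *: w) by [].
  by rewrite (diff_comp (is_diffW dl) dg') (is_diffE dl).
have [|s sh] := @MVT_line R V (fun y => g (y + h *: w) - g y) u v h h0.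
  move=> s sh; apply: differentiableB; last exact: dg (Os _ sh).
  exact: is_diffW (dsh _ (Ost _ _ sh hh)).
rewrite deriveB; last 2 first.
- exact: diff_derivable (is_diffW (dsh _ (Ost _ _ sh hh))).
- exact: diff_derivable (dg _ (Os _ sh)).
rewrite (deriveE _ (is_diffW (dsh _ (Ost _ _ sh hh)))) (is_diffE (dsh _ (Ost _ _ sh hh))).
rewrite -(deriveE _ (dg _ (Ost _ _ sh hh))) (gvE _ (Ost _ _ sh hh)) (gvE _ (Os _ sh)) => E.
have [t th Et] := @MVT_line R V gv (u + s *: v) w h h0 (fun t th => dgv _ (Ost _ _ sh th)).
by exists s, t; split => //; rewrite E Et.
Qed.

Lemma schwarz {R : realType} {V : normedModType R} (O : set V) (u v w : V)
    (g gv gw gvw gwv : V -> R) :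
  nbhs u O ->
  (forall y, O y -> differentiable g y) ->
  (forall y, O y -> differentiable gv y) -> (forall y, O y -> differentiable gw y) ->
  (forall y, O y -> 'D_v g y = gv y) -> (forall y, O y -> 'D_w g y = gw y) ->
  (forall y, O y -> 'D_w gv y = gvw y) -> (forall y, O y -> 'D_v gw y = gwv y) ->
  {for u, continuous gvw} -> {for u, continuous gwv} -> gvw u = gwv u.
Proof.
move=> nO dg dgv dgw gvE gwE gvwE gwvE cvw cwv.
apply/eqP; rewrite -subr_eq0 -normr_le0; apply/ler_addgt0Pr => e e0.
have e20 : 0 < e / 2 by rewrite divr_gt0.
have n1 : \forall y \near u, `|gvw u - gvw y| < e / 2 by exact: (cvgrPdist_lt _ _).1 cvw _ e20.
have n2 : \forall y \near u, `|gwv u - gwv y| < e / 2 by exact: (cvgrPdist_lt _ _).1 cwv _ e20.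
have nN : nbhs u (O `&` ([set y | `|gvw u - gvw y| < e / 2] `&`
    [set y | `|gwv u - gwv y| < e / 2])) by exact: filterI nO (filterI n1 n2).
have [r /= r0 rN] := (nbhs_ballP _ _).1 nN.
pose c := `|v| + `|w| + 1; have c0 : 0 < c by rewrite ltr_wpDl// addr_ge0.
pose h := r / c; have h0 : 0 < h by rewrite divr_gt0.
have inN (s t : R) : 0 <= s <= h -> 0 <= t <= h -> ball u r (u + (s *: v + t *: w)).
  move=> /andP[s0 sh] /andP[t0 th].
  rewrite -ball_normE /ball_/= opprD addrA subrr sub0r normrN.
  apply: (le_lt_trans (ler_normD _ _)); rewrite !normrZ !ger0_norm//.
  apply: (@le_lt_trans _ _ (h * `|v| + h * `|w|)).
    by apply: lerD; exact: ler_wpM2r.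
  by rewrite -mulrDr /h mulrAC ltr_pdivrMr// ltr_pM2l// ltrDl.
have O1 (s t : R) : 0 <= s <= h -> 0 <= t <= h -> O (u + s *: v + t *: w).
  by move=> sh th; rewrite -addrA; exact: (rN _ (inN _ _ sh th)).1.
have O2 (s t : R) : 0 <= s <= h -> 0 <= t <= h -> O (u + s *: w + t *: v).
  by move=> sh th; rewrite -addrA [_ + t *: v]addrC; exact: (rN _ (inN _ _ th sh)).1.
have [s [t [sh th E1]]] := second_difference h0 O1 dg dgv gvE.
have [s' [t' [sh' th' E2]]] := second_difference h0 O2 dg dgw gwE.
move: E1 E2; rewrite (gvwE _ (O1 _ _ sh th)) (gwvE _ (O2 _ _ sh' th')).
have /= [_ [N1 _]] := rN _ (inN _ _ sh th).
have /= [_ [_ N2]] := rN _ (inN _ _ th' sh').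
have -> : u + s' *: w + t' *: v = u + (t' *: v + s' *: w) by rewrite -addrA [in LHS](addrC (s' *: w)).
have -> : u + s *: v + t *: w = u + (s *: v + t *: w) by rewrite -addrA.
have -> : u + h *: w + h *: v = u + h *: v + h *: w by rewrite addrAC.
move=> E1 E2; have E : gvw (u + (s *: v + t *: w)) = gwv (u + (t' *: v + s' *: w)).
  have hn : h != 0 by rewrite gt_eqF.
  apply: (mulfI hn); apply: (mulfI hn); rewrite -E1 -E2.
  by rewrite !opprB addrACA [RHS]addrACA; lra.
move: N1 N2; rewrite E !ltr_norml add0r ler_norml => /andP[a1 a2] /andP[b1 b2].
by apply/andP; split; lra.
Qed.

Lemma schwarz_rV {R : realType} {V : normedModType R} {m : nat} (O : set V)
    (f : V -> 'rV[R]_m) (u v w : V) :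
  open O -> O u -> Ck 2 O f -> 'D_w ('D_v f) u = 'D_v ('D_w f) u.
Proof.
move=> oO Ou [df Cf]; apply/rowP => j.
have D (g : V -> 'rV[R]_m) (y z : V) : differentiable g y ->
    differentiable (fun x => g x 0 j) y /\ 'D_z (fun x => g x 0 j) y = 'D_z g y 0 j.
  move=> dg; split.
    exact: (differentiable_comp (f := g) (g := fun M : 'rV[R]_m => M 0 j) dg (differentiable_coord _ _ _)).
  by rewrite derive_mx ?mxE//; exact: diff_derivable.
have cD (g : V -> 'rV[R]_m) : {for u, continuous g} -> {for u, continuous (fun x => g x 0 j)}.
  move=> cg; apply: (continuous_comp (f := g) (g := fun M : 'rV[R]_m => M 0 j)) => //.
  exact: coord_continuous.
apply: (@schwarz R V O u v w (fun x => f x 0 j) (fun x => 'D_v f x 0 j)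
  (fun x => 'D_w f x 0 j) (fun x => 'D_w ('D_v f) x 0 j) (fun x => 'D_v ('D_w f) x 0 j)).
- exact: open_nbhs_nbhs.
- by move=> y Oy; exact: (D _ _ 0 (df _ Oy)).1.
- by move=> y Oy; exact: (D _ _ 0 ((Cf v).1 _ Oy)).1.
- by move=> y Oy; exact: (D _ _ 0 ((Cf w).1 _ Oy)).1.
- by move=> y Oy; exact: (D _ _ _ (df _ Oy)).2.
- by move=> y Oy; exact: (D _ _ _ (df _ Oy)).2.
- by move=> y Oy; exact: (D _ _ _ ((Cf v).1 _ Oy)).2.
- by move=> y Oy; exact: (D _ _ _ ((Cf w).1 _ Oy)).2.
- exact/cD/((Cf v).2 w).
- exact/cD/((Cf w).2 v).
Qed.

Lemma derive_diff_field {R : realType} {n m : nat} (O : set 'rV[R]_n)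
    (f : 'rV[R]_n -> 'rV[R]_m) (a : 'rV[R]_n -> 'rV[R]_n) (u v : 'rV[R]_n) :
  open O -> O u -> Ck 2 O f -> differentiable a u ->
  'D_v (fun y => 'd f y (a y)) u = 'd f u ('D_v a u) + 'D_v ('D_(a u) f) u.
Proof.
move=> oO Ou [df Cf] da.
pose e i : 'rV[R]_n := delta_mx 0 i.
have dE y z : O y -> 'd f y z = \sum_i z 0 i *: 'D_(e i) f y.
  move=> Oy; rewrite {1}[z]row_sum_delta linear_sum; apply: eq_bigr => i _.
  by rewrite linearZ deriveE//; exact: df.
have nO : \forall y \near u, O y by exact: open_nbhs_nbhs.
have dai i : derivable (fun y => a y 0 i) u v.
  by apply/(derivable_mxP _ _ _).1/diff_derivable.
have dav : derivable a u v by exact: diff_derivable.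
have dDi i : derivable ('D_(e i) f) u v by exact/diff_derivable/(Cf _).1.
have dDij i j : derivable (fun y => 'D_(e i) f y 0 j) u v by apply/(derivable_mxP _ _ _).1.
have dt i : derivable (fun y => a y 0 i *: 'D_(e i) f y) u v.
  apply/derivable_mxP => k j; rewrite ord1.
  rewrite (_ : (fun _ => _) = (fun y => a y 0 i * 'D_(e i) f y 0 j)); last first.
    by apply/funext => y; rewrite mxE.
  exact: derivableM.
pose F i y := a y 0 i *: 'D_(e i) f y.
rewrite (@near_eq_derive _ _ _ _ (\sum_i F i)); last first.
  by apply: filterS nO => y Oy; rewrite fct_sumE; exact: dE.
rewrite (@near_eq_derive _ _ _ ('D_(a u) f) (\sum_i a u 0 i *: 'D_(e i) f)); last first.
  by apply: filterS nO => y Oy; rewrite deriveE ?dE ?fct_sumE//; exact: df.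
rewrite (derive_sum dt) (derive_sum (fun i => @derivableZ _ _ _ _ (a u 0 i) _ _ (dDi i))).
rewrite dE// -big_split; apply: eq_bigr => i _ /=.
rewrite (deriveZ _ (dDi i)); apply/rowP => j.
rewrite (derive_mx (dt i)) mxE.
rewrite (_ : (fun _ => _) = (fun y => a y 0 i) * (fun y => 'D_(e i) f y 0 j)); last first.
  by apply/funext => y; rewrite mxE.
rewrite (deriveM (dai i) (dDij i j)) (derive_mx dav).
rewrite (derive_mx (dDi i)) !mxE addrC; congr (_ + _).
by rewrite -[LHS]/(_ * _) mulrC.
Qed.

Lemma derive_comp {R : realType} {U V W : normedModType R} (f : U -> V)
    (g : V -> W) (u v : U) :
  differentiable f u -> differentiable g (f u) ->
  'd g (f u) ('d f u v) = 'D_v (g \o f) u.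
Proof.
move=> df dg; have dgf : differentiable (g \o f) u by exact: differentiable_comp.
by rewrite (deriveE v dgf) (diff_comp df dg).
Qed.

Lemma diff_pushforward {R : realType} {n : nat} (O : set 'rV[R]_n)
    (T a a' : 'rV[R]_n -> 'rV[R]_n) (u v w : 'rV[R]_n) :
  open O -> O u -> Ck 2 O T -> T u = w ->
  differentiable a u -> differentiable a' w ->
  (forall y, O y -> a' (T y) = 'd T y (a y)) ->
  'd a' w ('d T u v) = 'd T u ('d a u v) + 'D_v ('D_(a u) T) u.
Proof.
move=> oO Ou CT <- da da' aT; have dT : differentiable T u by exact: CT.1.
have e1 := etrans (derive_diff_field v oO Ou CT da)
  (congr1 (fun z => 'd T u z + 'D_v ('D_(a u) T) u) (deriveE v da)).
apply: etrans e1; apply: (etrans (derive_comp v dT da')).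
apply: near_eq_derive.
have : nbhs u O by exact: open_nbhs_nbhs.
by apply: filterS => y /aT.
Qed.

Lemma bracket_pushforward {R : realType} {n : nat} (O : set 'rV[R]_n)
    (T a a' b b' : 'rV[R]_n -> 'rV[R]_n) (u w : 'rV[R]_n) :
  open O -> O u -> Ck 2 O T -> T u = w ->
  differentiable a u -> differentiable a' w ->
  differentiable b u -> differentiable b' w ->
  (forall y, O y -> a' (T y) = 'd T y (a y)) ->
  (forall y, O y -> b' (T y) = 'd T y (b y)) ->
  'd b' w (a' w) - 'd a' w (b' w) = 'd T u ('d b u (a u) - 'd a u (b u)).
Proof.
move=> oO Ou CT Tu da da' db db' aT bT.
have ea : a' w = 'd T u (a u) by rewrite -Tu aT.
have eb : b' w = 'd T u (b u) by rewrite -Tu bT.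
have pb := etrans (congr1 ('d b' w) ea) (diff_pushforward (a u) oO Ou CT Tu db db' bT).
have pa := etrans (congr1 ('d a' w) eb) (diff_pushforward (b u) oO Ou CT Tu da da' aT).
have cancel (A B Q Q' : 'rV[R]_n) : Q = Q' -> A + Q - (B + Q') = A - B.
  by move=> ->; rewrite opprD addrACA subrr addr0.
apply: etrans (congr2 (fun p q => p - q) pb pa) _.
apply: etrans (cancel _ _ _ _ (schwarz_rV _ _ oO Ou CT)) _.
exact: esym (linearB _ _ _).
Qed.

Section Bracket.
Context {R : realType} {n : nat} {M : manifold R n}.
Implicit Types (c d : chart_index M) (x : M) (X Y : vfield M).
Local Notation tr c d := (transition (atlas c) (atlas d)).

Lemma tangentE x (v : tangent x) c d : cdom (atlas c) x -> cdom (atlas d) x ->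
  v d = 'd (tr c d) (cmap (atlas c) x) (v c).
Proof. by case: v => v /= /asboolP[_]; exact. Qed.

Lemma chart_rep_transition c d Y x : cdom (atlas c) x -> cdom (atlas d) x ->
  chart_rep d Y (tr c d (cmap (atlas c) x)) =
  'd (tr c d) (cmap (atlas c) x) (chart_rep c Y (cmap (atlas c) x)).
Proof.
move=> cx dx; rewrite transitionE// /chart_rep !cmapK//; exact: tangentE.
Qed.

Lemma bracket_rep_transition (U : set M) c d X Y x :
  open U -> U x -> C1_on U X -> C1_on U Y ->
  cdom (atlas c) x -> cdom (atlas d) x ->
  bracket_rep d X Y (cmap (atlas d) x) =
  'd (tr c d) (cmap (atlas c) x) (bracket_rep c X Y (cmap (atlas c) x)).
Proof.
move=> oU Ux CX CY cx dx.
have dif Z e : C1_on U Z -> cdom (atlas e) x ->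
    differentiable (chart_rep e Z) (cmap (atlas e) x).
  by move=> CZ ex; apply: (CZ e).1; exists x.
apply: (@bracket_pushforward R n
  (cmap (atlas c) @` (cdom (atlas c) `&` cdom (atlas d)))).
- by rewrite setIC; exact/open_chart_image/open_cdom.
- by exists x.
- exact: atlas_compat.
- exact: transitionE.
- exact: dif.
- exact: dif.
- exact: dif.
- exact: dif.
- by move=> _ [y [cy dy] <-]; exact: chart_rep_transition.
- by move=> _ [y [cy dy] <-]; exact: chart_rep_transition.
Qed.

Lemma LieE (U : set M) X Y x c :
  open U -> U x -> C1_on U X -> C1_on U Y -> cdom (atlas c) x ->
  Lie X Y x c = bracket_rep c X Y (cmap (atlas c) x).
Proof.
move=> oU Ux CX CY cx; rewrite /Lie; case: (chart_at x) => d dx.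
rewrite (tangentE _ dx cx) tangent_ofK.
by rewrite (bracket_rep_transition oU Ux CX CY dx cx).
Qed.

End Bracket.

(* Main.v *)
Require Import Defs.
From HB Require Import structures.
From mathcomp Require Import all_boot all_order all_algebra.
From mathcomp Require Import all_classical all_reals all_analysis.
Import Order.TTheory GRing.Theory Num.Theory.
Import numFieldNormedType.Exports.
Local Open Scope classical_set_scope.
Local Open Scope ring_scope.
Set Implicit Arguments.
Unset Strict Implicit.
Unset Printing Implicit Defensive.

(** Only the case [X x0 <> 0] has content. In a chart at [x0], with [u0] the
    coordinates of [x0] and [a != 0] those of [X x0], the components of
    [D_X E_j] at [x0] are
      [d E_j (a) - d X (E_j) + S_X (E_j)],
    the differentials being taken at [u0]. Once the value of [E_j] at [x0] is
    chosen, say the [j]-th coordinate vector, the last two terms are fixed, and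
    the only condition left is that the derivative of [E_j] at [u0] in the
    single direction [a] be a prescribed vector [b_j]. Since [a != 0], this can
    be achieved: if [a_k != 0], the field
      [E_j (u) = delta_j + ((u_k - u0_k) / a_k) b_j]
    has derivative [b_j] along [a]. (If [X x0 = 0] the first term is always
    zero, which is why that case needs a hypothesis.)

    [frame_with_derivative] turns these coordinate expressions into a local
    frame of the manifold. Two points are to be checked. Independence near
    [x0]: the matrix of the fields is [1 + t B] with [t] a continuous function
    of the point vanishing at [x0], and the set of [t] for which it is
    invertible is open because its determinant is a polynomial in [t]
    ([open_unitmx_line]). Regularity in every chart, not only in the one used
    for the construction: in another chart the components are
    [d T (y) (e y)] composed with the inverse of [T], for [T] the change of
    coordinates, so that the C^2 regularity of [T] gives C^1 components
    ([Ck1_diff_field], [Ck1_comp], [C1_onW]). *)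

(** * Functions of class C^1 on an open set *)

Section C1.
Context {R : realType}.
Implicit Types (V W : normedModType R).

(** The differential is chosen by a description operator, so that the first step
    is to show that the differential of [f] also approximates [g]. *)
Lemma near_eq_differentiable V W (f g : V -> W) (u : V) :
  {near u, f =1 g} -> differentiable f u -> differentiable g u.
Proof.
move=> fg df; have gE : g \o shift u = cst (g u) + 'd f u +o_ 0 id.
  apply/eqaddoP => _/posnumP[e]; have := diff_locally df => /eqaddoP /(_ e%:num).
  move=> /(_ ltac:(by [])).
  have : {near (0 : V), f \o shift u =1 g \o shift u}.
    by move: fg; rewrite (near_shift 0) subr0.
  rewrite -(nbhs_singleton fg).
  by apply: filterS2 => y /= fgy; rewrite !fctE /= fgy.
have dE : 'd g u = 'd f u :> (V -> W).
  by apply: diff_unique gE; exact: diff_continuous.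
by apply/diff_locallyP; rewrite dE; split=> //; exact: diff_continuous.
Qed.

Lemma near_eq_continuous (T U : topologicalType) (f g : T -> U) (x : T) :
  {near x, f =1 g} -> {for x, continuous f} -> {for x, continuous g}.
Proof.
move=> fg cf; rewrite /prop_for /continuous_at -(nbhs_singleton fg).
exact: cvg_trans (near_eq_cvg fg) cf.
Qed.

Lemma Ck1_sub V W (O O' : set V) (f : V -> W) :
  O' `<=` O -> Ck 1 O f -> Ck 1 O' f.
Proof. by move=> sO [df cf]; split=> [u /sO|v u /sO]; [exact: df|exact: cf]. Qed.

Lemma Ck1_eq V W (O : set V) (f g : V -> W) :
  open O -> {in O, f =1 g} -> Ck 1 O f -> Ck 1 O g.
Proof.
move=> oO fg [df cf].
have fgn u : O u -> {near u, f =1 g}.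
  by move=> Ou; near=> y; apply/fg/mem_set; near: y; exact: open_nbhs_nbhs.
split=> [u Ou|v u Ou]; first exact: near_eq_differentiable (fgn _ Ou) (df _ Ou).
have near_D : {near u, 'D_v f =1 'D_v g}.
  have : nbhs u O by exact: open_nbhs_nbhs.
  by apply: filterS => y Oy; exact/near_eq_derive/fgn.
exact: near_eq_continuous near_D (cf v u Ou).
Unshelve. all: by end_near. Qed.

Lemma Ck1_cst V W (O : set V) (w : W) : Ck 1 O (fun _ => w).
Proof.
split=> [u _|v u _]; first exact: differentiable_cst.
rewrite (_ : 'D_v _ = fun=> 0); first exact: cvg_cst.
by apply/funext => y; exact: derive_cst.
Qed.

Lemma Ck1D V W (O : set V) (f g : V -> W) :
  open O -> Ck 1 O f -> Ck 1 O g -> Ck 1 O (f + g).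
Proof.
move=> oO [df cf] [dg cg]; split=> [u Ou|v u Ou].
  by apply: differentiableD; [exact: df|exact: dg].
have near_D : {near u, 'D_v f + 'D_v g =1 'D_v (f + g)}.
  have : nbhs u O by exact: open_nbhs_nbhs.
  apply: filterS => y Oy; rewrite deriveD//; apply: diff_derivable.
  + exact: df.
  + exact: dg.
apply: (near_eq_continuous near_D).
by apply: cvgD; [exact: cf|exact: cg].
Qed.

Lemma Ck1_sum V W (O : set V) (I : Type) (r : seq I) (F : I -> V -> W) :
  open O -> (forall i, Ck 1 O (F i)) -> Ck 1 O (\sum_(i <- r) F i).
Proof.
move=> oO CF; elim/big_ind : _ => // [|f g]; [exact: Ck1_cst | exact: Ck1D].
Qed.

Lemma Ck1M V (O : set V) (f g : V -> R) :
  open O -> Ck 1 O f -> Ck 1 O g -> Ck 1 O (f * g).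
Proof.
move=> oO [df cf] [dg cg]; split=> [u Ou|v u Ou].
  by apply: differentiableM; [exact: df|exact: dg].
have near_D : {near u, (fun y => f y *: 'D_v g y) + (fun y => g y *: 'D_v f y)
                  =1 'D_v (f * g)}.
  have : nbhs u O by exact: open_nbhs_nbhs.
  apply: filterS => y Oy; rewrite deriveM//; apply: diff_derivable.
  + exact: df.
  + exact: dg.
apply: (near_eq_continuous near_D).
apply: cvgD; apply: cvgZ.
- exact/differentiable_continuous/df.
- exact: cg.
- exact/differentiable_continuous/dg.
- exact: cf.
Qed.

Lemma Ck1Zl V W (O : set V) (k : V -> R) (w : W) :
  open O -> Ck 1 O k -> Ck 1 O (fun y => k y *: w).
Proof.
move=> oO [dk ck]; split=> [u Ou|v u Ou]; first exact/differentiableZl/dk.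
have near_D : {near u, (fun y => 'D_v k y *: w) =1 'D_v (fun y => k y *: w)}.
  have : nbhs u O by exact: open_nbhs_nbhs.
  apply: filterS => y Oy; rewrite !deriveE; [|exact/differentiableZl/dk|exact: dk].
  by rewrite diffZl//; exact: dk.
apply: (near_eq_continuous near_D).
by apply: cvgZr_tmp; exact: ck.
Qed.

Lemma Ck1_coord V m (O : set V) (f : V -> 'rV[R]_m) j :
  open O -> Ck 1 O f -> Ck 1 O (fun y => f y 0 j).
Proof.
move=> oO [df cf]; split=> [u Ou|v u Ou].
  exact: (differentiable_comp (df _ Ou) (differentiable_coord (f u) 0 j)).
have near_D : {near u, (fun y => 'D_v f y 0 j) =1 'D_v (fun y => f y 0 j)}.
  have : nbhs u O by exact: open_nbhs_nbhs.
  by apply: filterS => y Oy; rewrite derive_mx ?mxE//; exact/diff_derivable/df.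
apply: (near_eq_continuous near_D).
apply: (continuous_comp (f := 'D_v f) (g := fun M : 'rV[R]_m => M 0 j)).
  exact: cf.
exact: coord_continuous.
Qed.

(** Reduced to the scalar product rule by expanding [f] on the coordinate
    basis: only products by constant vectors remain. *)
Lemma Ck1Z V m (O : set V) (k : V -> R) (f : V -> 'rV[R]_m) :
  open O -> Ck 1 O k -> Ck 1 O f -> Ck 1 O (fun y => k y *: f y).
Proof.
move=> oO Ck Cf.
rewrite (_ : (fun _ => _) =
    \sum_j (fun y => (k * (fun y => f y 0 j)) y *: delta_mx 0 j)).
  apply: (Ck1_sum _ oO) => j.
  exact: (Ck1Zl _ oO (Ck1M oO Ck (Ck1_coord j oO Cf))).
apply/funext => y; rewrite fct_sumE [in LHS](row_sum_delta (f y)) scaler_sumr.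
by apply: eq_bigr => j _; rewrite scalerA.
Qed.

Lemma diff_sum_derive n W (f : 'rV[R]_n -> W) (u z : 'rV[R]_n) :
  differentiable f u -> 'd f u z = \sum_i z 0 i *: 'D_(delta_mx 0 i) f u.
Proof.
move=> df; rewrite [in LHS](row_sum_delta z) linear_sum; apply: eq_bigr => i _.
by rewrite linearZ deriveE.
Qed.

(** The chain rule, with the differential of [g] expanded along the coordinate
    directions: the directional derivatives of [g o T] are then sums of products
    of functions known to be continuous. *)
Lemma Ck1_comp V W n (O : set V) (O' : set 'rV[R]_n) (T : V -> 'rV[R]_n)
    (g : 'rV[R]_n -> W) :
  open O -> (forall y, O y -> O' (T y)) -> Ck 1 O T -> Ck 1 O' g ->
  Ck 1 O (g \o T).
Proof.
move=> oO OO' [dT cT] [dg cg]; split=> [u Ou|v u Ou].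
  by apply: differentiable_comp; [exact: dT | exact/dg/OO'].
pose F i y := 'D_v T y 0 i *: 'D_(delta_mx 0 i) g (T y).
have near_D : {near u, \sum_i F i =1 'D_v (g \o T)}.
  have : nbhs u O by exact: open_nbhs_nbhs.
  apply: filterS => y Oy; have dTy := dT _ Oy; have dgy := dg _ (OO' _ Oy).
  rewrite -(derive_comp v dTy dgy) diff_sum_derive// fct_sumE.
  by apply: eq_bigr => i _; rewrite -deriveE.
apply: (near_eq_continuous near_D).
elim/big_ind : _ => [|f h cf ch|i _]; [exact: cvg_cst | exact: cvgD |].
apply: cvgZ.
  apply: (continuous_comp (f := 'D_v T) (g := fun M : 'rV[R]_n => M 0 i)).
    exact: cT.
  exact: coord_continuous.
apply: (continuous_comp (f := T) (g := 'D_(delta_mx 0 i) g)).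
  exact/differentiable_continuous/dT.
exact/cg/OO'.
Qed.

(** The components in a new chart of a vector field with components [a], [f]
    being the change of coordinates: one derivative of [f] is used up. *)
Lemma Ck1_diff_field n m (O : set 'rV[R]_n) (f : 'rV[R]_n -> 'rV[R]_m)
    (a : 'rV[R]_n -> 'rV[R]_n) :
  open O -> Ck 2 O f -> Ck 1 O a -> Ck 1 O (fun y => 'd f y (a y)).
Proof.
move=> oO [df Cf] Ca.
apply: (@Ck1_eq _ _ _ (\sum_i (fun y => a y 0 i *: 'D_(delta_mx 0 i) f y))) => //.
  by move=> y /set_mem Oy; rewrite fct_sumE diff_sum_derive//; exact: df.
apply: (Ck1_sum _ oO) => i.
exact: (Ck1Z oO (Ck1_coord i oO Ca) (Cf _)).
Qed.

Lemma Ck2W V W (O : set V) (f : V -> W) : Ck 2 O f -> Ck 1 O f.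
Proof.
move=> [df Cf]; split=> // v u Ou; apply: differentiable_continuous.
exact: (Cf v).1.
Qed.

End C1.

(** * Vector fields prescribed in a chart *)

Section ChartFields.
Context {R : realType} {n : nat} {M : manifold R n}.
Implicit Types (c d : chart_index M) (x : M).

Definition field_of c (e : 'rV[R]_n -> 'rV[R]_n) : vfield M := fun x =>
  if pselect (cdom (atlas c) x) is left cx
  then tangent_of cx (e (cmap (atlas c) x)) else 0.

Lemma field_ofE c e x : cdom (atlas c) x ->
  field_of c e x c = e (cmap (atlas c) x).
Proof. by move=> cx; rewrite /field_of; case: pselect => // cx'; exact: tangent_ofK. Qed.

Lemma chart_rep_field_of c e u : (cmap (atlas c) @` cdom (atlas c)) u ->
  chart_rep c (field_of c e) u = e u.
Proof. by move=> [x cx <-]; rewrite /chart_rep cmapK// field_ofE. Qed.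

(** Regularity has to be checked in one chart only. *)
Lemma C1_onW c (U : set M) (Y : vfield M) :
  open U -> U `<=` cdom (atlas c) ->
  Ck 1 (cmap (atlas c) @` U) (chart_rep c Y) -> C1_on U Y.
Proof.
move=> oU Uc CY d; pose O := cmap (atlas d) @` (U `&` cdom (atlas d)).
have oO : open O by exact: open_chart_image.
pose O' := cmap (atlas c) @` ((U `&` cdom (atlas d)) `&` cdom (atlas c)).
have oO' : open O' by apply: open_chart_image; exact/openI/open_cdom.
pose T := transition (atlas d) (atlas c).
apply: (@Ck1_eq _ _ _ _
  ((fun y => 'd (transition (atlas c) (atlas d)) y (chart_rep c Y y)) \o T)) => //.
  move=> _ /set_mem[x [Ux dx] <-]; have cx := Uc _ Ux.
  by rewrite /= /T transitionE// -chart_rep_transition// transitionE.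
apply: (@Ck1_comp _ _ _ _ O O') => //.
- by move=> _ [x [Ux dx] <-]; rewrite /T transitionE//; exists x => //; split=> //; exact: Uc.
- apply: (@Ck1_sub _ _ _ _ _ _ _ (Ck2W (atlas_compat d c))).
  by move=> _ [x [Ux dx] <-]; exists x => //; split=> //; exact: Uc.
apply: Ck1_diff_field => //.
- have [df Cf] := atlas_compat c d.
  have s : O' `<=` cmap (atlas c) @` (cdom (atlas c) `&` cdom (atlas d)).
    by move=> _ [x [[Ux dx] cx] <-]; exists x.
  split=> [u /s|v]; first exact: df.
  exact: Ck1_sub s (Cf v).
- by apply: Ck1_sub CY => _ [x [[Ux dx] cx] <-]; exists x.
Qed.

Lemma open_chart_preimage c (V : set 'rV[R]_n) :
  open V -> open (cdom (atlas c) `&` cmap (atlas c) @^-1` V).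
Proof.
move=> oV; rewrite openE => x [cx Vx]; apply: filterI.
  by apply: open_nbhs_nbhs; split=> //; exact: open_cdom.
by apply: (cmap_continuous cx); exact: open_nbhs_nbhs.
Qed.

(** A linear relation between the fields at [x], read in the chart [c], is a row
    vector killed by an invertible matrix. *)
Lemma chart_frame c (e : 'I_n -> 'rV[R]_n -> 'rV[R]_n) x : cdom (atlas c) x ->
  \matrix_i e i (cmap (atlas c) x) \in unitmx ->
  basis_of fullv (frame_at (fun i => field_of c (e i)) x).
Proof.
move=> cx ue; rewrite basisEfree subvf size_tuple dimvf leqnn !andbT.
apply/freeP => k k0; suff /rowP k0' : \row_i k i = 0.
  by move=> i; have := k0' i; rewrite !mxE.
apply: (row_free_inj (A := \matrix_i e i (cmap (atlas c) x))).
  by rewrite row_free_unit.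
rewrite mul0mx mulmx_sum_row.
have tc : {morph (fun v : tangent x => v c) : v w / v + w >-> v + w} by [].
have t0 : (0 : tangent x) c = 0 by [].
transitivity ((\sum_(i < n) k i *: (frame_at (fun i => field_of c (e i)) x)`_i) c).
  rewrite (big_morph (fun v : tangent x => v c) tc t0); apply: eq_bigr => i _.
  rewrite mxE rowK (nth_map i) ?size_enum_ord// nth_ord_enum.
  by rewrite -(field_ofE (e i) cx).
by rewrite k0.
Qed.

End ChartFields.

(** The determinant along a line of matrices is a polynomial function of the
    parameter, hence continuous. *)
Lemma open_unitmx_line (R : realType) n (A B : 'M[R]_n) :
  open [set t : R | A + t *: B \in unitmx].
Proof.
pose p := \det (map_mx polyC A + 'X *: map_mx polyC B).
have pE t : p.[t] = \det (A + t *: B).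
  rewrite -horner_evalE /p -det_map_mx; congr (\det _).
  by apply/matrixP => i j; rewrite !mxE /= !horner_evalE !hornerE.
rewrite (_ : mkset _ = horner p @^-1` [set y | y != 0]).
  by apply: open_comp; [move=> t _; exact: continuous_horner | exact: open_neq].
by apply/seteqP; split=> t /=; rewrite unitmxE unitfE pE.
Qed.

(** * Affine fields with a prescribed derivative along one direction *)

Section AffineFields.
Context {R : realType} {n : nat}.
Implicit Types (u v a b : 'rV[R]_n) (k : 'I_n) (O : set 'rV[R]_n).

(** An affine function vanishing at [u0] and growing at unit speed in the
    direction [a], when [a 0 k != 0]. *)
Definition coord_along u0 a k u : R := (u 0 k - u0 0 k) / a 0 k.

Lemma coord_along_C1 O u0 a k : open O -> Ck 1 O (coord_along u0 a k).
Proof.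
move=> oO; have Cid : Ck 1 O (@idfun 'rV[R]_n).
  split=> [u _|w u _]; first exact: ex_diff.
  rewrite (_ : 'D_w _ = fun=> w); first exact: cst_continuous.
  by apply/funext => y; exact: derive_id.
exact: (Ck1M oO (Ck1D oO (Ck1_coord k oO Cid) (Ck1_cst _ _)) (Ck1_cst _ _)).
Qed.

Definition affine_field u0 a k v b u : 'rV[R]_n := v + coord_along u0 a k u *: b.

Lemma affine_field_C1 O u0 a k v b : open O -> Ck 1 O (affine_field u0 a k v b).
Proof.
by move=> oO; exact: (Ck1D oO (Ck1_cst _ v) (Ck1Zl b oO (coord_along_C1 _ _ _ oO))).
Qed.

Lemma affine_field_center u0 a k v b : affine_field u0 a k v b u0 = v.
Proof. by rewrite /affine_field /coord_along subrr mul0r scale0r addr0. Qed.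

(** Along the direction [a] the difference quotient is constant, equal to [b]. *)
Lemma affine_field_derive u0 a k v b u :
  a 0 k != 0 -> 'D_a (affine_field u0 a k v b) u = b.
Proof.
move=> ak0; apply: cvg_lim => //; apply: cvg_near_cst.
have : \forall h \near (0 : R)^', h != 0 by exact: nbhs_dnbhs_neq.
apply: filterS => h h0; rewrite /affine_field /coord_along /= opprD addrACA subrr add0r.
rewrite -scalerBl scalerA !mxE -mulrBl opprB addrA subrK addrK mulfK//.
by rewrite mulVf ?scale1r.
Qed.

End AffineFields.

(** * Frames adapted to a direction *)

(** The derivative along [a] can be arbitrary, because the affine fields take the
    values of the coordinate basis at [x0] whatever the [b j]: independence holds
    there, hence nearby, and only the size of [U] depends on [b]. *)
Lemma frame_with_derivative (R : realType) (n : nat) (M : manifold R n)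
    (c : chart_index M) (x0 : M) (a : 'rV[R]_n) (b : 'I_n -> 'rV[R]_n) :
  cdom (atlas c) x0 -> a != 0 ->
  exists (U : set M) (E : 'I_n -> vfield M),
    [/\ U x0, local_frame U E,
      forall j, E j x0 c = delta_mx 0 j &
      forall j, 'd (chart_rep c (E j)) (cmap (atlas c) x0) a = b j].
Proof.
move=> cx0 /rV0Pn[k ak0]; set u0 := cmap (atlas c) x0.
pose t := coord_along u0 a k; pose e j := affine_field u0 a k (delta_mx 0 j) (b j).
have eE u : \matrix_i e i u = 1%:M + t u *: \matrix_i b i.
  by apply/row_matrixP => i; rewrite rowK linearD linearZ /= rowK row1.
pose V := [set u | \matrix_i e i u \in unitmx].
have oV : open V.
  rewrite (_ : V = t @^-1` [set s | 1%:M + s *: \matrix_i b i \in unitmx]).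
    apply: open_comp; last exact: open_unitmx_line.
    move=> u _; apply: differentiable_continuous.
    exact: (coord_along_C1 u0 a k (@openT _)).1.
  by apply/seteqP; split=> u /=; rewrite /V /= eE.
pose U := cdom (atlas c) `&` cmap (atlas c) @^-1` V.
have oU : open U by exact: open_chart_preimage.
have Uc : U `<=` cdom (atlas c) by move=> x [].
have Ux0 : U x0.
  split=> //; rewrite /= /V /= (_ : \matrix_i _ = 1%:M) ?unitmx1//.
  by apply/row_matrixP => i; rewrite rowK row1; exact: affine_field_center.
have oI : open (cmap (atlas c) @` U).
  by rewrite -(setIidl Uc); exact: open_chart_image.
pose E j := field_of c (e j).
have repE j u : (cmap (atlas c) @` U) u -> chart_rep c (E j) u = e j u.
  by move=> [x /Uc cx <-]; apply: chart_rep_field_of; exists x.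
have CE j : C1_on U (E j).
  apply: (C1_onW oU Uc); apply: (Ck1_eq oI _ (affine_field_C1 _ _ _ _ _ oI)).
  by move=> u /set_mem /repE ->.
have Iu0 : (cmap (atlas c) @` U) u0 by exists x0.
exists U, E; split=> // [|j|j].
- by split=> // x [cx Vx]; exact: chart_frame.
- by rewrite field_ofE//; exact: affine_field_center.
have de : differentiable (e j) u0 by apply: (affine_field_C1 _ _ _ _ _ oI).1.
have dE : differentiable (chart_rep c (E j)) u0 by apply: (CE j c).1; exists x0.
rewrite (near_eq_diff a dE de).
  by rewrite -deriveE// affine_field_derive.
have : nbhs u0 (cmap (atlas c) @` U) by exact: open_nbhs_nbhs.
exact: filterS (repE j).
Qed.

Theorem proposition8 (R : realType) (n : nat) (M : manifold R n)
    (S : C1_vfield M -> tensor11 M) (x0 : M) (X : C1_vfield M) :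
  (X x0 <> 0 ->
     exists (U : set M) (E : 'I_n -> vfield M),
       [/\ U x0, local_frame U E & components (S_derivation S X) E x0 = 0]) /\
  (X x0 = 0 ->
     (exists (U : set M) (E : 'I_n -> vfield M),
       [/\ U x0, local_frame U E & components (S_derivation S X) E x0 = 0]) ->
     exists (U' : set M) (E' : 'I_n -> vfield M),
       [/\ U' x0, local_frame U' E' & components (S_derivation S X) E' x0 = 0]).
Proof.
split=> // X0; have [c cx0] := atlas_cover x0.
pose u0 := cmap (atlas c) x0; pose f j := tangent_of cx0 (delta_mx 0 j).
have a0 : X x0 c != 0.
  by apply/eqP => Xc0; exact/X0/(tangent_eq cx0).
(* the derivatives along [X x0] which make [L_X E_j] cancel [S_X E_j] *)
pose b j : 'rV[R]_n :=
  'd (chart_rep c X) u0 (delta_mx 0 j) - S X x0 (f j) c.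
have [U [E [Ux0 fE E0 dE]]] := frame_with_derivative b cx0 a0.
exists U, E; split=> //; apply/matrixP => i j; rewrite !mxE.
suff -> : S_derivation S X (E j) x0 = 0 by rewrite linear0.
have [oU CE _] := fE; have CX : C1_on U X.
  have CX : C1_on setT X by case: X {X0 a0 b dE}.
  by move=> d; apply: Ck1_sub (CX d) => _ [x [_ dx] <-]; exists x.
have Ef : E j x0 = f j by apply: (tangent_eq cx0); rewrite tangent_ofK E0.
apply: (tangent_eq cx0).
have rep0 Y : chart_rep c Y u0 = Y x0 c by rewrite /chart_rep cmapK.
have cancel (p q s : 'rV[R]_n) : p = q - s -> p - q + s = 0.
  by move=> ->; rewrite addrAC subrK subrr.
transitivity (Lie X (E j) x0 c + S X x0 (E j x0) c) => //.
rewrite (LieE oU Ux0 CX (CE j) cx0) /bracket_rep !rep0 E0 Ef.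
apply: cancel; exact: dE.
Qed.
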